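(* For positive integers $l,m,p$, \begin{align*} &(-1)^m\sum_{n=1}^\infty\frac{\bar H_n^{(l)}}{n^{p+1}}\Big(\sum_{i=1}^n\frac{\bar H_i}{i^m}(-1)^{i-1}\Big)+(-1)^{p+l}\sum_{n=1}^\infty\frac{\bar H_n^{(m)}}{n^{p+1}}\Big(\sum_{i=1}^n\frac{\bar H_i}{i^l}(-1)^{i-1}\Big)\\ &=\sum_{i=1}^{p-1}(-1)^{i-1}S_{\bar m,i+1}\, S_{\bar l,p+1-i}+(-1)^{p-1}\bar\zeta(l+1)S_{\bar m,p+1}-\bar\zeta(m+1)S_{\bar l,p+1}\\ &\quad+(-1)^{p-1}\sum_{j=1}^{l-1}(-1)^{j-1}\bar\zeta(l+1-j)\big(S_{\bar mj,p+1}-S_{\bar m,p+j+1}\big)\\ &\quad-\sum_{j=1}^{m-1}(-1)^{j-1}\bar\zeta(m+1-j)\big(S_{\bar lj,p+1}-S_{\bar l,p+j+1}\big)\\ &\quad+(-1)^{p+l}\ln2\,\big(S_{\bar ml,p+1}+S_{\bar m\bar l,p+1}-S_{\bar m,p+l+1}-S_{\bar m,\overline{p+l+1}}\big)\\ &\quad+(-1)^m\ln2\,\big(S_{\bar lm,p+1}+S_{\bar l\bar m,p+1}-S_{\bar l,m+p+1}-S_{\bar l,\overline{m+p+1}}\big)\\ &\quad+(-1)^{p+l}S_{\bar1\bar m,\overline{p+l+1}}+(-1)^mS_{\bar1\bar l,\overline{p+m+1}}. \end{align*}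
   Context: For positive integers $r$ and $n\ge0$: $H_n^{(r)}=\sum_{j=1}^n j^{-r}$, $\bar H_n^{(r)}=\sum_{j=1}^n(-1)^{j-1}j^{-r}$, $\bar H_n=\bar H_n^{(1)}$. $\bar\zeta(s)=\sum_{n\ge1}(-1)^{n-1}n^{-s}$. For positive integers $a,b$ and $q\ge2$: $S_{\bar a,q}=\sum_{n\ge1}\bar H_n^{(a)}/n^q$; $S_{\bar a,\overline q}=\sum_{n\ge1}(-1)^{n-1}\bar H_n^{(a)}/n^q$; $S_{\bar ab,q}=\sum_{n\ge1}\bar H_n^{(a)}H_n^{(b)}/n^q$; $S_{\bar a\bar b,q}=\sum_{n\ge1}\bar H_n^{(a)}\bar H_n^{(b)}/n^q$; $S_{\bar1\bar a,\overline q}=\sum_{n\ge1}(-1)^{n-1}\bar H_n\bar H_n^{(a)}/n^q$. Empty sums are $0$. *)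

(* Defs.v *)
From Stdlib Require Import Reals.
From Coquelicot Require Import Coquelicot.
Open Scope R_scope.

(* Coquelicot's [sum_n_m f 1 n] is f 1 + ... + f n, and 0 when n = 0. *)
Definition fsum (f : nat -> R) (n : nat) : R := sum_n_m f 1 n.

(* Coquelicot's [Series] starts at index 0; the series here start at 1. *)
Definition Series1 (f : nat -> R) : R := Series (fun n => f (S n)).

(* The sign (-1)^(n-1); only used for n >= 1, where [n - 1] is not truncated. *)
Definition sgn1 (n : nat) : R := (-1) ^ (n - 1).

Definition H (r n : nat) : R := fsum (fun j => / INR j ^ r) n.

Definition Hbar (r n : nat) : R := fsum (fun j => sgn1 j / INR j ^ r) n.

Definition zetabar (s : nat) : R := Series1 (fun n => sgn1 n / INR n ^ s).

(* In the names below, B stands for a barred index: [S_B_q a q] is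
   S_{\bar a,q}, [S_B_Bq a q] is S_{\bar a,\bar q}, [S_BN_q a b q] is
   S_{\bar a b,q}, [S_BB_q a b q] is S_{\bar a\bar b,q}, and [S_1B_Bq a q] is
   S_{\bar 1\bar a,\bar q}. *)
Definition S_B_q (a q : nat) : R :=
  Series1 (fun n => Hbar a n / INR n ^ q).

Definition S_B_Bq (a q : nat) : R :=
  Series1 (fun n => sgn1 n * Hbar a n / INR n ^ q).

Definition S_BN_q (a b q : nat) : R :=
  Series1 (fun n => Hbar a n * H b n / INR n ^ q).

Definition S_BB_q (a b q : nat) : R :=
  Series1 (fun n => Hbar a n * Hbar b n / INR n ^ q).

Definition S_1B_Bq (a q : nat) : R :=
  Series1 (fun n => sgn1 n * Hbar 1 n * Hbar a n / INR n ^ q).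

(* Main.v *)
Require Import Defs.
From Stdlib Require Import Reals Lra Lia.
From Coquelicot Require Import Coquelicot.
Open Scope R_scope.

(** Put [A_m(n) = sum_k Hbar m k (1/k - 1/(n+k))].  Abel summation gives
    [A_m(n) - A_m(n-1) = sum_k (-1)^(k-1) / (k^m (k+n-1))], and partial
    fractions evaluate this through values of [zetabar] and a tail of the
    series of [ln 2].  On the other hand,
    [sum_n Hbar l n / n^(p+1) A_m(n)] is the double series
    [sum_(n,k) Hbar l n Hbar m k / (n^p k (n+k))], and the identity
    [1/(n^(s+1) k^t (n+k)) + 1/(n^s k^(t+1) (n+k)) = 1/(n^(s+1) k^(t+1))]
    moves the exponent [p] from [n] to [k] one unit at a time, at the cost of
    the products of linear sums.  Substituting the values of [A_m] and [A_l]
    into the resulting reciprocity gives the theorem. *)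

(** * Finite sums and series indexed from 1 *)

Lemma fsum_0 (f : nat -> R) : fsum f 0 = 0.
Proof. unfold fsum. rewrite sum_n_m_zero by lia. reflexivity. Qed.

Lemma fsum_S (f : nat -> R) (n : nat) : fsum f (S n) = fsum f n + f (S n).
Proof. unfold fsum. rewrite sum_n_Sm by lia. reflexivity. Qed.

Lemma fsum_ext (f g : nat -> R) (n : nat) :
  (forall k, (1 <= k <= n)%nat -> f k = g k) -> fsum f n = fsum g n.
Proof.
  induction n as [|n IH]; intros E; [now rewrite !fsum_0|].
  rewrite !fsum_S, IH, E; auto; try lia. intros k Hk; apply E; lia.
Qed.

Lemma fsum_plus (f g : nat -> R) (n : nat) :
  fsum (fun k => f k + g k) n = fsum f n + fsum g n.
Proof.
  induction n as [|n IH]; [rewrite !fsum_0; ring|].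
  rewrite !fsum_S, IH; ring.
Qed.

Lemma fsum_scal (c : R) (f : nat -> R) (n : nat) :
  fsum (fun k => c * f k) n = c * fsum f n.
Proof.
  induction n as [|n IH]; [rewrite !fsum_0; ring|].
  rewrite !fsum_S, IH; ring.
Qed.

Lemma fsum_minus (f g : nat -> R) (n : nat) :
  fsum (fun k => f k - g k) n = fsum f n - fsum g n.
Proof.
  induction n as [|n IH]; [rewrite !fsum_0; ring|].
  rewrite !fsum_S, IH; ring.
Qed.

Lemma fsum_swap (f : nat -> nat -> R) (n m : nat) :
  fsum (fun i => fsum (fun j => f i j) m) n =
  fsum (fun j => fsum (fun i => f i j) n) m.
Proof.
  induction n as [|n IH].
  - rewrite fsum_0. induction m as [|m IHm]; [now rewrite fsum_0|].
    rewrite fsum_S, <- IHm, fsum_0; ring.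
  - rewrite fsum_S, IH, <- fsum_plus. apply fsum_ext; intros j _.
    now rewrite fsum_S.
Qed.

Lemma fsum_Rabs_le (f g : nat -> R) (n : nat) :
  (forall k, (1 <= k <= n)%nat -> Rabs (f k) <= g k) ->
  Rabs (fsum f n) <= fsum g n.
Proof.
  induction n as [|n IH]; intros E; [rewrite !fsum_0, Rabs_R0; lra|].
  rewrite !fsum_S. eapply Rle_trans; [apply Rabs_triang|].
  apply Rplus_le_compat; [apply IH; intros k Hk|]; apply E; lia.
Qed.

(** [Series1] returns a number even for a divergent series, so convergence and value are carried
    together in this form. *)
Definition is_sum (f : nat -> R) (l : R) : Prop := is_lim_seq (fsum f) l.

Lemma is_sum_series (f : nat -> R) (l : R) :
  is_sum f l <-> is_series (fun n => f (S n)) l.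
Proof.
  assert (E : forall n, fsum f (S n) = sum_n (fun k => f (S k)) n).
  { intros n. unfold fsum, sum_n. now rewrite sum_n_m_S. }
  unfold is_sum. rewrite is_lim_seq_incr_1.
  split; intros L.
  - exact (is_lim_seq_ext _ _ l E L).
  - exact (is_lim_seq_ext _ _ l (fun n => eq_sym (E n)) L).
Qed.

Lemma is_sum_unique (f : nat -> R) (l : R) : is_sum f l -> Series1 f = l.
Proof. intros L. now apply is_series_unique, is_sum_series. Qed.

Lemma is_sum_ext (f g : nat -> R) (l : R) :
  (forall n, (1 <= n)%nat -> f n = g n) -> is_sum f l -> is_sum g l.
Proof.
  intros E. apply is_lim_seq_ext. intros N. apply fsum_ext.
  intros k Hk; apply E; lia.
Qed.

Lemma is_sum_plus (f g : nat -> R) (a b : R) :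
  is_sum f a -> is_sum g b -> is_sum (fun n => f n + g n) (a + b).
Proof.
  intros Hf Hg. unfold is_sum.
  apply is_lim_seq_ext with (fun N => fsum f N + fsum g N).
  - intros N. now rewrite fsum_plus.
  - now apply is_lim_seq_plus'.
Qed.

Lemma is_sum_minus (f g : nat -> R) (a b : R) :
  is_sum f a -> is_sum g b -> is_sum (fun n => f n - g n) (a - b).
Proof.
  intros Hf Hg. unfold is_sum.
  apply is_lim_seq_ext with (fun N => fsum f N - fsum g N).
  - intros N. now rewrite fsum_minus.
  - now apply is_lim_seq_minus'.
Qed.

Lemma is_sum_scal (c : R) (f : nat -> R) (a : R) :
  is_sum f a -> is_sum (fun n => c * f n) (c * a).
Proof.
  intros Hf. unfold is_sum.
  apply is_lim_seq_ext with (fun N => c * fsum f N).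
  - intros N. now rewrite fsum_scal.
  - exact (is_lim_seq_scal_l _ c a Hf).
Qed.

Lemma is_sum_zero : is_sum (fun _ => 0) 0.
Proof.
  unfold is_sum. apply is_lim_seq_ext with (fun _ => 0).
  - induction n as [|n IH]; [now rewrite fsum_0|]. rewrite fsum_S, <- IH; ring.
  - apply is_lim_seq_const.
Qed.

Lemma is_sum_fsum (f : nat -> nat -> R) (a : nat -> R) (m : nat) :
  (forall j, (1 <= j <= m)%nat -> is_sum (fun n => f n j) (a j)) ->
  is_sum (fun n => fsum (f n) m) (fsum a m).
Proof.
  induction m as [|m IH]; intros E.
  - rewrite fsum_0. apply is_sum_ext with (fun _ => 0); [|apply is_sum_zero].
    intros n _. now rewrite fsum_0.
  - rewrite fsum_S.
    apply is_sum_ext with (fun n => fsum (f n) m + f n (S m)).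
    + intros n _. now rewrite fsum_S.
    + apply is_sum_plus; [apply IH; intros j Hj|]; apply E; lia.
Qed.

(** Comparison test: [g] dominates an absolute value, hence is nonnegative, and its bounded partial
    sums increase to a limit. *)
Lemma is_sum_dominated (f g : nat -> R) (M : R) :
  (forall n, (1 <= n)%nat -> Rabs (f n) <= g n) ->
  (forall N, fsum g N <= M) ->
  is_sum f (Series1 f).
Proof.
  intros Hfg HM. apply is_sum_series. apply Series_correct.
  apply (ex_series_le (fun n => f (S n)) (fun n => g (S n))).
  - intros n. apply Hfg; lia.
  - destruct (ex_finite_lim_seq_incr (fsum g) M) as [L HL].
    + intros n. rewrite fsum_S. generalize (Hfg (S n) ltac:(lia)).
      generalize (Rabs_pos (f (S n))); lra.
    + exact HM.
    + exists L. now apply (is_sum_series g L).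
Qed.

(** * Reciprocal powers and signs *)

Lemma INR_pos (n : nat) : (1 <= n)%nat -> 0 < INR n.
Proof. intros Hn. apply lt_0_INR; lia. Qed.

Lemma inv_pow_bounds (n r : nat) :
  (1 <= n)%nat -> 0 < / INR n ^ r <= 1.
Proof.
  intros Hn. assert (1 <= INR n) by (apply (le_INR 1); lia).
  assert (1 <= INR n ^ r) by now apply pow_R1_Rle.
  split; [apply Rinv_0_lt_compat; lra|].
  rewrite <- Rinv_1. apply Rinv_le_contravar; lra.
Qed.

Lemma inv_pow_le_inv (n r : nat) :
  (1 <= n)%nat -> (1 <= r)%nat -> / INR n ^ r <= / INR n.
Proof.
  intros Hn Hr. assert (1 <= INR n) by (apply (le_INR 1); lia).
  apply Rinv_le_contravar; [lra|].
  rewrite <- (pow_1 (INR n)) at 1. apply Rle_pow; assumption.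
Qed.

Lemma sgn1_S (n : nat) : sgn1 (S n) = (-1) ^ n.
Proof. unfold sgn1. f_equal. lia. Qed.

Lemma sgn1_cases (n : nat) : sgn1 n = 1 \/ sgn1 n = -1.
Proof.
  unfold sgn1. induction (n - 1)%nat as [|k [IH|IH]]; simpl; [left; lra|right|left];
    rewrite IH; lra.
Qed.

Lemma Rabs_sgn1 (n : nat) : Rabs (sgn1 n) = 1.
Proof.
  destruct (sgn1_cases n) as [->| ->]; unfold Rabs; destruct Rcase_abs; lra.
Qed.

Lemma is_lim_seq_inv_S (i : nat) :
  is_lim_seq (fun n => / (INR n + INR i + 1)) 0.
Proof.
  apply is_lim_seq_ext with (fun n => / INR (n + S i)).
  - intros n. rewrite plus_INR, S_INR. f_equal; ring.
  - apply (is_lim_seq_incr_n (fun n => / INR n)).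
    replace (Finite 0) with (Rbar_inv p_infty) by reflexivity.
    apply is_lim_seq_inv; [apply is_lim_seq_INR|discriminate].
Qed.

(** * Harmonic numbers *)

Lemma Hbar_bounds (r n : nat) : 0 <= Hbar r n <= 1.
Proof.
  assert (D : forall k, (1 <= k)%nat -> / INR (S k) ^ r <= / INR k ^ r).
  { intros k Hk. apply Rinv_le_contravar; [now apply pow_lt, INR_pos|].
    apply pow_incr. split; [apply pos_INR|]. apply le_INR; lia. }
  destruct n as [|n]; [unfold Hbar; rewrite fsum_0; lra|].
  (* Strengthened for the induction: after a positive term the sum is at least that term, after a
     negative one at most [1] minus its size, so the next term, which is no larger, cannot leave the
     interval. *)
  enough (E : (sgn1 (S n) = 1 /\ / INR (S n) ^ r <= Hbar r (S n) <= 1) \/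
    (sgn1 (S n) = -1 /\ 0 <= Hbar r (S n) <= 1 - / INR (S n) ^ r)).
  { destruct (inv_pow_bounds (S n) r ltac:(lia)). destruct E; lra. }
  induction n as [|n IH].
  - left. unfold Hbar. rewrite fsum_S, fsum_0. unfold sgn1; simpl.
    rewrite pow1. lra.
  - assert (Es : sgn1 (S (S n)) = - sgn1 (S n)).
    { rewrite !sgn1_S. simpl. ring. }
    assert (EH : Hbar r (S (S n)) =
      Hbar r (S n) - sgn1 (S n) * / INR (S (S n)) ^ r).
    { unfold Hbar. rewrite fsum_S, Es. unfold Rdiv. ring. }
    specialize (D (S n) ltac:(lia)).
    destruct (inv_pow_bounds (S (S n)) r ltac:(lia)).
    rewrite EH, Es. destruct IH as [[-> ?]|[-> ?]]; [right|left]; lra.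
Qed.

Lemma Rabs_Hbar_le_1 (r n : nat) : Rabs (Hbar r n) <= 1.
Proof. apply Rabs_le. generalize (Hbar_bounds r n); lra. Qed.

Lemma H1_S (n : nat) : H 1 (S n) = H 1 n + / (INR n + 1).
Proof. unfold H. rewrite fsum_S, pow_1, S_INR. reflexivity. Qed.

Lemma H1_ge_1 (n : nat) : (1 <= n)%nat -> 1 <= H 1 n.
Proof.
  destruct n as [|n]; [lia|]. intros _. induction n as [|n IH].
  - rewrite H1_S. unfold H. rewrite fsum_0. simpl. lra.
  - rewrite H1_S. assert (0 < / (INR (S n) + 1)); [|lra].
    apply Rinv_0_lt_compat. generalize (pos_INR (S n)); lra.
Qed.

(** For [n >= 1], [H 1 n / n] is the mean of the first [n] terms of the null sequence [1 / (k + 1)],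
    so Cesaro's theorem applies. This limit absorbs the truncation error of the double series. *)
Lemma H1_div_tends_0 : is_lim_seq (fun n => H 1 n / (INR n + 1)) 0.
Proof.
  assert (C : is_lim_seq
    (fun n => sum_f_R0 (fun k => / (INR k + 1)) (Init.Nat.pred n) / INR n) 0).
  { apply is_lim_seq_Reals, Cesaro_1, is_lim_seq_Reals.
    apply is_lim_seq_ext with (fun n => / (INR n + INR 0 + 1)).
    - intros n. simpl. f_equal; ring.
    - apply is_lim_seq_inv_S. }
  apply (is_lim_seq_le_le_loc (fun _ => 0)) with
    (2 := is_lim_seq_const 0) (3 := C).
  exists 1%nat. intros [|n] Hn; [lia|].
  assert (E : sum_f_R0 (fun k => / (INR k + 1)) n = H 1 (S n)).
  { clear. induction n as [|n IH].
    - rewrite H1_S. unfold H. rewrite fsum_0. simpl. ring.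
    - rewrite H1_S, <- IH. reflexivity. }
  cbn [Init.Nat.pred]. rewrite E.
  assert (P := H1_ge_1 (S n) ltac:(lia)).
  assert (Q := INR_pos (S n) ltac:(lia)).
  split.
  - apply Rmult_le_pos; [lra|]. left; apply Rinv_0_lt_compat; lra.
  - apply Rmult_le_compat_l; [lra|]. apply Rinv_le_contravar; lra.
Qed.

(* With [g n = (H 1 n + 1) / n] one has
   [H 1 n / (n (n + 1)) <= g n - g (n + 1)], so the sum telescopes. *)
Lemma fsum_H1_sq_le (N : nat) : fsum (fun n => H 1 n / INR n ^ 2) N <= 4.
Proof.
  (* Since [1 / n^2 <= 2 / (n (n + 1))], the telescoping bound is doubled; [4] is [2 * g 1]. *)
  enough (E : (1 <= N)%nat -> fsum (fun n => H 1 n / INR n ^ 2) N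
              <= 4 - 2 * (H 1 (S N) + 1) / INR (S N)).
  { destruct N as [|N]; [rewrite fsum_0; lra|].
    eapply Rle_trans; [apply E; lia|].
    assert (0 <= 2 * (H 1 (S (S N)) + 1) / INR (S (S N))); [|lra].
    apply Rmult_le_pos.
    - generalize (H1_ge_1 (S (S N)) ltac:(lia)); lra.
    - left. apply Rinv_0_lt_compat, INR_pos. lia. }
  destruct N as [|N]; [lia|]. intros _. induction N as [|N IH].
  - rewrite fsum_S, fsum_0, !H1_S. unfold H. rewrite fsum_0. simpl. lra.
  - rewrite fsum_S. set (n := S (S N)) in *.
    eapply Rle_trans; [apply Rplus_le_compat_r, IH|].
    rewrite (H1_S n), S_INR.
    assert (P := H1_ge_1 n ltac:(unfold n; lia)).
    assert (Q : 1 <= INR n) by (apply (le_INR 1); unfold n; lia).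
    set (h := H 1 n) in *. set (x := INR n) in *.
    assert (E : 4 - 2 * (h + / (x + 1) + 1) / (x + 1)
      - (4 - 2 * (h + 1) / x + h / x ^ 2)
      = (h * (x - 1) * (x + 1) + 2 * x) / (x ^ 2 * (x + 1) ^ 2)).
    { field. lra. }
    assert (0 <= (h * (x - 1) * (x + 1) + 2 * x) / (x ^ 2 * (x + 1) ^ 2)); [|lra].
    apply Rmult_le_pos.
    + assert (0 <= h * (x - 1) * (x + 1)); [|lra].
      apply Rmult_le_pos; [apply Rmult_le_pos|]; lra.
    + left. apply Rinv_0_lt_compat, Rmult_lt_0_compat; apply pow_lt; lra.
Qed.

(** One criterion serves all the Euler sums: every numerator that occurs grows at most like [H 1 n],
    and [q >= 2] reduces the denominator to [n^2]. *)
Lemma is_sum_H1_dominated (w : nat -> R) (q : nat) :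
  (2 <= q)%nat ->
  (forall n, (1 <= n)%nat -> Rabs (w n) <= H 1 n) ->
  is_sum (fun n => w n / INR n ^ q) (Series1 (fun n => w n / INR n ^ q)).
Proof.
  intros Hq Hw.
  apply is_sum_dominated with (fun n => H 1 n / INR n ^ 2) 4;
    [|apply fsum_H1_sq_le].
  intros n Hn. unfold Rdiv. rewrite Rabs_mult.
  assert (P := inv_pow_bounds n q Hn).
  rewrite (Rabs_pos_eq (/ _)) by lra.
  apply Rmult_le_compat; [apply Rabs_pos|lra|auto|].
  assert (1 <= INR n) by (apply (le_INR 1); lia).
  apply Rinv_le_contravar; [apply pow_lt; lra|].
  apply Rle_pow; assumption.
Qed.

(** At [s = 1] convergence is only conditional, so Leibniz's test replaces domination. *)
Lemma zetabar_is_sum (s : nat) :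
  (1 <= s)%nat -> is_sum (fun n => sgn1 n / INR n ^ s) (zetabar s).
Proof.
  intros Hs. apply is_sum_series, Series_correct.
  destruct (alternated_series (fun n => / INR (S n) ^ s)) as [L HL].
  - intros n. apply Rinv_le_contravar; [apply pow_lt, INR_pos; lia|].
    apply pow_incr. split; [apply pos_INR|]. apply le_INR; lia.
  - apply is_lim_seq_Reals.
    apply (is_lim_seq_le_le (fun _ => 0)) with (fun n => / (INR n + INR 0 + 1)).
    + intros n. destruct (inv_pow_bounds (S n) s ltac:(lia)).
      split; [lra|]. simpl INR at 3. rewrite Rplus_0_r, <- S_INR.
      apply inv_pow_le_inv; [lia|assumption].
    + apply is_lim_seq_const.
    + apply is_lim_seq_inv_S.
  - exists L. apply is_lim_seq_Reals in HL.
    refine (is_lim_seq_ext _ _ L _ HL). intros n.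
    rewrite <- sum_n_Reals. apply sum_n_ext. intros k.
    unfold tg_alt. rewrite sgn1_S. reflexivity.
Qed.

(** * Harmonic numbers, the logarithm and [ln 2] *)

Lemma ln_succ_bounds (n : nat) :
  (1 <= n)%nat ->
  / (INR n + 1) <= ln (INR n + 1) - ln (INR n) <= / INR n.
Proof.
  intros Hn. assert (P := INR_pos n Hn).
  (* This tangent bound is applied to [n / (n + 1)] for the lower estimate and to [(n + 1) / n] for
     the upper one. *)
  assert (L : forall x, 0 < x -> ln x <= x - 1).
  { intros x Hx. rewrite <- (ln_exp (x - 1)).
    apply ln_le; [assumption|]. generalize (exp_ineq1_le (x - 1)); lra. }
  assert (Q := Rinv_0_lt_compat _ P).
  assert (Q' : 0 < / (INR n + 1)) by (apply Rinv_0_lt_compat; lra).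
  split.
  - assert (A := L (INR n * / (INR n + 1)) ltac:(now apply Rmult_lt_0_compat)).
    rewrite ln_mult, ln_Rinv in A by lra.
    replace (INR n * / (INR n + 1) - 1) with (- / (INR n + 1)) in A
      by (field; lra). lra.
  - assert (A := L ((INR n + 1) * / INR n)
      ltac:(apply Rmult_lt_0_compat; lra)).
    rewrite ln_mult, ln_Rinv in A by lra.
    replace ((INR n + 1) * / INR n - 1) with (/ INR n) in A by (field; lra).
    lra.
Qed.

(** Telescoping: [1 / (j + 1)] is at least [ln (j + 2) - ln (j + 1)] and at most
    [ln (j + 1) - ln j], summed over [n <= j < n + k]. *)
Lemma H1_ln_bounds (n k : nat) :
  (1 <= n)%nat ->
  ln (INR (n + k) + 1) - ln (INR n + 1) <= H 1 (n + k) - H 1 n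
  <= ln (INR (n + k)) - ln (INR n).
Proof.
  intros Hn. induction k as [|k IH]; [rewrite Nat.add_0_r; lra|].
  rewrite Nat.add_succ_r, H1_S.
  assert (A := ln_succ_bounds (n + k) ltac:(lia)).
  assert (B := ln_succ_bounds (S (n + k)) ltac:(lia)).
  rewrite S_INR in *. lra.
Qed.

(** Flipping the signs of the even terms of [H 1 (2n)] removes twice their sum, which is [H 1 n]. *)
Lemma Hbar_1_double (n : nat) : Hbar 1 (n + n) = H 1 (n + n) - H 1 n.
Proof.
  induction n as [|n IH]; [unfold Hbar, H; rewrite !fsum_0; ring|].
  replace (S n + S n)%nat with (S (S (n + n))) by lia.
  rewrite !H1_S. unfold Hbar in *. rewrite !fsum_S, IH, !sgn1_S.
  replace (S (n + n)) with (S (2 * n)) by lia.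
  replace ((-1) ^ (n + n)) with ((-1) ^ (2 * n)) by (f_equal; lia).
  rewrite pow_1_odd, pow_1_even, !pow_1, !S_INR, mult_INR, plus_INR.
  change (INR 2) with 2. generalize (pos_INR n); intros P. field. lra.
Qed.

(** The limit is known to exist, so it may be read off along the even partial sums
    [H 1 (2n) - H 1 n], which logarithms squeeze. *)
Lemma zetabar_1 : zetabar 1 = ln 2.
Proof.
  assert (Z := zetabar_is_sum 1 (le_n 1)).
  assert (F : filterlim (fun n => (n + n)%nat) eventually eventually).
  { intros P [N HN]. exists N. intros n Hn. apply HN. lia. }
  apply (is_lim_seq_subseq _ _ _ F) in Z.
  assert (L : is_lim_seq (fun n => Hbar 1 (n + n)) (ln 2)).
  { apply (is_lim_seq_le_le_loc (fun n => ln 2 - / (INR n + INR 0 + 1)))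
      with (fun _ => ln 2).
    - exists 1%nat. intros n Hn. rewrite Hbar_1_double.
      assert (A := H1_ln_bounds n n Hn).
      (* Passing from [ln (2n + 1)] to [ln (2n + 2)] costs at most [1 / (2n + 1)] and lets
         [ln (n + 1)] cancel. *)
      assert (B := ln_succ_bounds (n + n + 1) ltac:(lia)).
      assert (P := INR_pos n Hn).
      rewrite !plus_INR in *. simpl (INR 1) in B. simpl (INR 0).
      replace (INR n + INR n) with (2 * INR n) in * by ring.
      rewrite (ln_mult 2 (INR n)) in A by lra.
      replace (2 * INR n + 1 + 1) with (2 * (INR n + 1)) in B by ring.
      rewrite (ln_mult 2 (INR n + 1)) in B by lra.
      assert (/ (2 * INR n + 1) <= / (INR n + 0 + 1))
        by (apply Rinv_le_contravar; lra).
      lra.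
    - replace (Finite (ln 2)) with (Finite (ln 2 - 0)) by (f_equal; ring).
      apply is_lim_seq_minus'; [apply is_lim_seq_const|apply is_lim_seq_inv_S].
    - apply is_lim_seq_const. }
  apply is_lim_seq_unique in Z. apply is_lim_seq_unique in L.
  change (fsum (fun n => sgn1 n / INR n ^ 1)) with (Hbar 1) in Z.
  rewrite Z in L. now injection L.
Qed.

(** * The series [sum_k Hbar m k (1/k - 1/(n+k))] *)

Lemma fsum_S_l (f : nat -> R) (n : nat) :
  fsum f (S n) = f 1%nat + fsum (fun k => f (S k)) n.
Proof.
  induction n as [|n IH]; [rewrite fsum_S, !fsum_0; ring|].
  rewrite fsum_S, IH, fsum_S; ring.
Qed.

(* The value of [sum_k (-1)^(k-1) / (k^m (k+i))] for [i >= 1]. *)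
Definition alt_shift (m i : nat) : R :=
  fsum (fun j => sgn1 j * zetabar (m + 1 - j) / INR i ^ j) m
  + (-1) ^ m * (sgn1 i * (Hbar 1 i - ln 2)) / INR i ^ m.

(** Up to the sign [(-1)^i] this is the series of [ln 2] with its first [i] terms removed. *)
Lemma alt_shift_0_is_sum (i : nat) :
  (1 <= i)%nat -> is_sum (fun k => sgn1 k / (INR k + INR i)) (alt_shift 0 i).
Proof.
  intros Hi. unfold alt_shift. rewrite fsum_0.
  assert (Z := zetabar_is_sum 1 (le_n 1)). rewrite zetabar_1 in Z.
  assert (E : forall N, fsum (fun k => sgn1 k / (INR k + INR i)) N =
    - sgn1 i * (Hbar 1 (N + i) - Hbar 1 i)).
  { induction N as [|N IH]; [rewrite fsum_0; simpl; ring|].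
    rewrite fsum_S, IH. simpl (S N + i)%nat. unfold Hbar. rewrite fsum_S.
    rewrite pow_1, !sgn1_S, !S_INR, plus_INR, pow_add.
    destruct i as [|i]; [lia|]. rewrite sgn1_S. simpl ((-1) ^ S i).
    assert (S2 : (-1) ^ i * (-1) ^ i = 1).
    { rewrite <- Rpow_mult_distr. replace (-1 * -1) with 1 by ring.
      apply pow1. }
    replace (INR N + INR (S i) + 1) with (INR N + 1 + INR (S i)) by ring.
    transitivity (- (-1) ^ i * (fsum (fun j => sgn1 j / INR j ^ 1) (N + S i)
       - fsum (fun j => sgn1 j / INR j ^ 1) (S i))
       + ((-1) ^ i * (-1) ^ i) * (-1) ^ N / (INR N + 1 + INR (S i))).
    - rewrite S2. field. generalize (pos_INR N), (pos_INR (S i)); lra.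
    - field. generalize (pos_INR N), (pos_INR (S i)); lra. }
  unfold is_sum.
  eapply is_lim_seq_ext; [intros N; symmetry; apply E|].
  replace (0 + (-1) ^ 0 * (sgn1 i * (Hbar 1 i - ln 2)) / INR i ^ 0)
    with (- sgn1 i * (ln 2 - Hbar 1 i)) by (simpl; field).
  apply (is_lim_seq_scal_l _ (- sgn1 i) (Finite (ln 2 - Hbar 1 i))).
  apply is_lim_seq_minus'; [|apply is_lim_seq_const].
  apply (is_lim_seq_incr_n (Hbar 1)). exact Z.
Qed.

(* Uses [1/(k^(m+1) (k+i)) = (1/k^(m+1) - 1/(k^m (k+i))) / i]. *)
Lemma alt_shift_is_sum (m i : nat) :
  (1 <= i)%nat ->
  is_sum (fun k => sgn1 k / (INR k ^ m * (INR k + INR i))) (alt_shift m i).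
Proof.
  intros Hi. assert (P := INR_pos i Hi).
  induction m as [|m IH].
  - apply is_sum_ext with (2 := alt_shift_0_is_sum i Hi).
    intros k _. simpl. now rewrite Rmult_1_l.
  - assert (Z := zetabar_is_sum (S m) ltac:(lia)).
    assert (A := is_sum_scal (/ INR i) _ _ (is_sum_minus _ _ _ _ Z IH)).
    cbv beta in A.
    replace (alt_shift (S m) i)
      with (/ INR i * (zetabar (S m) - alt_shift m i)).
    + apply is_sum_ext with (2 := A). intros k Hk.
      assert (Q := INR_pos k Hk). assert (W := pow_lt _ m Q).
      simpl pow. field. repeat split; lra.
    (* The term [j = 1] is the new [zetabar (S m) / i]; the others are the old terms shifted by one,
       each with a further factor [-1 / i]. *)
    + unfold alt_shift. rewrite fsum_S_l.
      replace (fsum (fun k => sgn1 (S k) * zetabar (S m + 1 - S k)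
                 / INR i ^ S k) m)
        with (- / INR i * fsum (fun j => sgn1 j * zetabar (m + 1 - j)
                 / INR i ^ j) m).
      * replace (S m + 1 - 1)%nat with (S m) by lia.
        assert (W := pow_lt _ m P).
        unfold sgn1 at 3. simpl pow. field. split; lra.
      * rewrite <- fsum_scal. apply fsum_ext. intros k Hk.
        replace (S m + 1 - S k)%nat with (m + 1 - k)%nat by lia.
        destruct k as [|k]; [lia|]. rewrite !sgn1_S.
        assert (W := pow_lt _ k P). simpl pow. field. split; lra.
Qed.

(** Abel summation; the boundary term [Hbar m N / (N + i + 1)] vanishes in the limit because [Hbar]
    is bounded. The value [b] stays a parameter: it is [zetabar (m + 1)] for [i = 0] and
    [alt_shift m i] for [i >= 1]. *)
Lemma Hbar_abel_is_sum (m i : nat) (b : R) :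
  is_sum (fun k => sgn1 k / (INR k ^ m * (INR k + INR i))) b ->
  is_sum (fun k => Hbar m k * (/ (INR k + INR i) - / (INR k + INR i + 1))) b.
Proof.
  intros B. unfold is_sum.
  assert (E : forall N,
    fsum (fun k => Hbar m k * (/ (INR k + INR i) - / (INR k + INR i + 1))) N
    = fsum (fun k => sgn1 k / (INR k ^ m * (INR k + INR i))) N
      - Hbar m N * / (INR N + INR i + 1)).
  { induction N as [|N IH]; [unfold Hbar; rewrite !fsum_0; ring|].
    rewrite !fsum_S, IH. unfold Hbar. rewrite fsum_S.
    assert (0 < INR (S N) ^ m) by (apply pow_lt, INR_pos; lia).
    rewrite S_INR in *. generalize (pos_INR N), (pos_INR i); intros.
    field. repeat split; lra. }
  eapply is_lim_seq_ext; [intros N; symmetry; apply E|].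
  replace (Finite b) with (Finite (b - 0)) by (f_equal; ring).
  apply is_lim_seq_minus'; [exact B|].
  apply (is_lim_seq_le_le (fun _ => 0)) with (fun N => / (INR N + INR i + 1));
    [|apply is_lim_seq_const|apply is_lim_seq_inv_S].
  intros N. assert (Q := Hbar_bounds m N).
  assert (0 < / (INR N + INR i + 1)).
  { apply Rinv_0_lt_compat. generalize (pos_INR N), (pos_INR i); lra. }
  split; [apply Rmult_le_pos; lra|].
  rewrite <- (Rmult_1_l (/ _)) at 2. apply Rmult_le_compat_r; lra.
Qed.

(* The index is shifted: [Hbar_diff m (n-1)] is the sum of the series for [n]. *)
Definition Hbar_diff (m n : nat) : R := zetabar (m + 1) + fsum (alt_shift m) n.

(** [1/k - 1/(k+n+1)] telescopes into the differences [1/(k+i) - 1/(k+i+1)] for [0 <= i <= n], each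
    summed by [Hbar_abel_is_sum]. *)
Lemma Hbar_diff_is_sum (m n : nat) :
  is_sum (fun k => Hbar m k * (/ INR k - / (INR k + INR n + 1)))
    (Hbar_diff m n).
Proof.
  unfold Hbar_diff. induction n as [|n IH].
  - rewrite fsum_0, Rplus_0_r.
    assert (A : is_sum (fun k => sgn1 k / (INR k ^ m * (INR k + INR 0)))
                  (zetabar (m + 1))).
    { apply is_sum_ext with (2 := zetabar_is_sum (m + 1) ltac:(lia)).
      intros k _. rewrite pow_add, pow_1. simpl (INR 0).
      now rewrite Rplus_0_r. }
    apply is_sum_ext with (2 := Hbar_abel_is_sum _ _ _ A).
    intros k _. simpl (INR 0). now rewrite Rplus_0_r.
  - rewrite fsum_S, <- Rplus_assoc.
    assert (A := alt_shift_is_sum m (S n) ltac:(lia)).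
    apply is_sum_ext with
      (2 := is_sum_plus _ _ _ _ IH (Hbar_abel_is_sum _ _ _ A)).
    intros k _. cbv beta. rewrite S_INR, <- Rplus_assoc. ring.
Qed.

(** Summing over [i] first turns [1 / i^j] into [H j n]; the remaining part of [alt_shift] produces
    the inner sum of the theorem and [ln 2 * Hbar m n]. *)
Lemma fsum_alt_shift (m n : nat) :
  fsum (alt_shift m) n =
  fsum (fun j => sgn1 j * zetabar (m + 1 - j) * H j n) m
  + (-1) ^ m * (fsum (fun i => Hbar 1 i / INR i ^ m * sgn1 i) n
                - ln 2 * Hbar m n).
Proof.
  unfold alt_shift. rewrite fsum_plus. f_equal.
  - rewrite fsum_swap. apply fsum_ext. intros j _.
    unfold H, Rdiv. now rewrite fsum_scal.
  - unfold Hbar at 3. rewrite <- fsum_scal, <- fsum_minus, <- fsum_scal.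
    apply fsum_ext. intros k _. unfold Rdiv. ring.
Qed.

(** The theorem has harmonic numbers at [n], while the value at [n - 1] is wanted. The last term of
    each sum is therefore subtracted, which is the source of the differences of Euler sums in the
    theorem. *)
Lemma Hbar_diff_pred (m n : nat) :
  (1 <= n)%nat ->
  Hbar_diff m (n - 1) =
  zetabar (m + 1)
  + fsum (fun j => sgn1 j * zetabar (m + 1 - j) * (H j n - / INR n ^ j)) m
  + (-1) ^ m * (fsum (fun i => Hbar 1 i / INR i ^ m * sgn1 i) n
                - sgn1 n * Hbar 1 n / INR n ^ m)
  - (-1) ^ m * ln 2 * (Hbar m n - sgn1 n / INR n ^ m).
Proof.
  destruct n as [|n]; [lia|]. intros _. simpl (S n - 1)%nat.
  rewrite Nat.sub_0_r. unfold Hbar_diff. rewrite fsum_alt_shift.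
  rewrite (fsum_ext (fun j => _ * (H j (S n) - _))
    (fun j => sgn1 j * zetabar (m + 1 - j) * H j n)).
  - rewrite fsum_S.
    replace (Hbar m (S n)) with (Hbar m n + sgn1 (S n) / INR (S n) ^ m)
      by (unfold Hbar; now rewrite fsum_S).
    unfold Rdiv. ring.
  - intros j _. unfold H. rewrite fsum_S. ring.
Qed.

(** * The double series *)

Lemma H_le_H1 (j n : nat) : (1 <= j)%nat -> Rabs (H j n) <= H 1 n.
Proof.
  intros Hj. apply fsum_Rabs_le. intros k Hk.
  assert (P := inv_pow_bounds k j ltac:(lia)).
  rewrite Rabs_pos_eq, pow_1 by lra. apply inv_pow_le_inv; lia.
Qed.

(** Growth at most [H 1 n] is all that [is_sum_H1_dominated] asks of these inner sums. *)
Lemma fsum_Hbar_1_le_H1 (m n : nat) :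
  (1 <= m)%nat ->
  Rabs (fsum (fun i => Hbar 1 i / INR i ^ m * sgn1 i) n) <= H 1 n.
Proof.
  intros Hm. apply fsum_Rabs_le. intros k Hk.
  unfold Rdiv. rewrite !Rabs_mult, Rabs_sgn1, Rmult_1_r, pow_1.
  assert (P := inv_pow_bounds k m ltac:(lia)).
  assert (Q := inv_pow_le_inv k m ltac:(lia) Hm).
  assert (T := Rabs_Hbar_le_1 1 k). assert (U := Rabs_pos (Hbar 1 k)).
  rewrite (Rabs_pos_eq (/ _)) by lra.
  rewrite <- (Rmult_1_l (/ INR k)). apply Rmult_le_compat; lra.
Qed.

Lemma Rabs_mult_Hbar_le (r n : nat) (x b : R) :
  Rabs x <= b -> Rabs (Hbar r n * x) <= b.
Proof.
  intros Hx. rewrite Rabs_mult.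
  assert (T := Rabs_Hbar_le_1 r n). assert (U := Rabs_pos x).
  eapply Rle_trans; [apply Rmult_le_compat_r; eassumption|]. lra.
Qed.

Lemma Rabs_Hbar_le_H1 (r n : nat) : (1 <= n)%nat -> Rabs (Hbar r n) <= H 1 n.
Proof.
  intros Hn. generalize (Rabs_Hbar_le_1 r n), (H1_ge_1 n Hn). lra.
Qed.

(** [Hbar_diff_pred] is weighted and summed term by term, each piece converging on its own. The
    index [j = m], where [zetabar 1] occurs, is still inside the finite sum. *)
Lemma Hbar_diff_weighted_is_sum (l m p : nat) :
  (1 <= m)%nat -> (1 <= p)%nat ->
  is_sum (fun n => Hbar l n / INR n ^ (p + 1) * Hbar_diff m (n - 1))
   (zetabar (m + 1) * S_B_q l (p + 1)
    + fsum (fun j => sgn1 j * zetabar (m + 1 - j) *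
                     (S_BN_q l j (p + 1) - S_B_q l (p + j + 1))) m
    + (-1) ^ m * (Series1 (fun n => Hbar l n / INR n ^ (p + 1) *
                      fsum (fun i => Hbar 1 i / INR i ^ m * sgn1 i) n)
                  - S_1B_Bq l (p + m + 1))
    - (-1) ^ m * ln 2 * (S_BB_q l m (p + 1) - S_B_Bq l (p + m + 1))).
Proof.
  intros Hm Hp.
  assert (B : forall q, (2 <= q)%nat ->
    is_sum (fun n => Hbar l n / INR n ^ q) (S_B_q l q)).
  { intros q Hq. apply is_sum_H1_dominated; [assumption|].
    apply Rabs_Hbar_le_H1. }
  assert (BN : forall j, (1 <= j)%nat ->
    is_sum (fun n => Hbar l n * H j n / INR n ^ (p + 1)) (S_BN_q l j (p + 1))).
  { intros j Hj. apply (is_sum_H1_dominated (fun n => Hbar l n * H j n));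
      [lia|]. intros n _. apply Rabs_mult_Hbar_le, H_le_H1, Hj. }
  assert (BB : is_sum (fun n => Hbar l n * Hbar m n / INR n ^ (p + 1))
    (S_BB_q l m (p + 1))).
  { apply (is_sum_H1_dominated (fun n => Hbar l n * Hbar m n)); [lia|].
    intros n Hn. apply Rabs_mult_Hbar_le, Rabs_Hbar_le_H1, Hn. }
  assert (BBq : is_sum (fun n => sgn1 n * Hbar l n / INR n ^ (p + m + 1))
    (S_B_Bq l (p + m + 1))).
  { apply (is_sum_H1_dominated (fun n => sgn1 n * Hbar l n)); [lia|].
    intros n Hn. rewrite Rabs_mult, Rabs_sgn1, Rmult_1_l.
    apply Rabs_Hbar_le_H1, Hn. }
  assert (B1 : is_sum
    (fun n => sgn1 n * Hbar 1 n * Hbar l n / INR n ^ (p + m + 1))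
    (S_1B_Bq l (p + m + 1))).
  { apply (is_sum_H1_dominated (fun n => sgn1 n * Hbar 1 n * Hbar l n));
      [lia|]. intros n Hn.
    rewrite Rmult_assoc, Rabs_mult, Rabs_sgn1, Rmult_1_l.
    apply Rabs_mult_Hbar_le, Rabs_Hbar_le_H1, Hn. }
  set (Y := fun n => fsum (fun i => Hbar 1 i / INR i ^ m * sgn1 i) n).
  assert (X : is_sum (fun n => Hbar l n / INR n ^ (p + 1) * Y n)
    (Series1 (fun n => Hbar l n / INR n ^ (p + 1) * Y n))).
  { assert (X0 := is_sum_H1_dominated (fun n => Hbar l n * Y n) (p + 1)
      ltac:(lia)
      (fun n _ => Rabs_mult_Hbar_le l n _ _ (fsum_Hbar_1_le_H1 m n Hm))).
    assert (X2 : is_sum (fun n => Hbar l n / INR n ^ (p + 1) * Y n)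
      (Series1 (fun n => Hbar l n * Y n / INR n ^ (p + 1)))).
    { apply is_sum_ext with (2 := X0). intros n _. unfold Rdiv. ring. }
    (* Uniqueness of the sum identifies the two ways of writing the general term inside
       [Series1]. *)
    now rewrite (is_sum_unique _ _ X2). }
  change (Series1 (fun n => Hbar l n / INR n ^ (p + 1) *
     fsum (fun i => Hbar 1 i / INR i ^ m * sgn1 i) n))
    with (Series1 (fun n => Hbar l n / INR n ^ (p + 1) * Y n)).
  assert (F := is_sum_fsum
    (fun n j => sgn1 j * zetabar (m + 1 - j) *
       (Hbar l n * H j n / INR n ^ (p + 1) - Hbar l n / INR n ^ (p + j + 1)))
    (fun j => sgn1 j * zetabar (m + 1 - j) *
       (S_BN_q l j (p + 1) - S_B_q l (p + j + 1))) m
    (fun j Hj => is_sum_scal _ _ _ (is_sum_minus _ _ _ _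
       (BN j (proj1 Hj)) (B (p + j + 1)%nat ltac:(lia))))).
  assert (T := is_sum_minus _ _ _ _
    (is_sum_plus _ _ _ _
      (is_sum_plus _ _ _ _
         (is_sum_scal (zetabar (m + 1)) _ _ (B (p + 1)%nat ltac:(lia))) F)
      (is_sum_scal ((-1) ^ m) _ _ (is_sum_minus _ _ _ _ X B1)))
    (is_sum_scal ((-1) ^ m * ln 2) _ _ (is_sum_minus _ _ _ _ BB BBq))).
  apply is_sum_ext with (2 := T). intros n Hn. cbv beta.
  rewrite Hbar_diff_pred by assumption. fold (Y n).
  assert (P := INR_pos n Hn).
  rewrite (fsum_ext _ (fun j => Hbar l n / INR n ^ (p + 1) *
     (sgn1 j * zetabar (m + 1 - j) * (H j n - / INR n ^ j)))).
  - rewrite fsum_scal, !pow_add, pow_1.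
    assert (W := pow_lt _ p P). assert (W' := pow_lt _ m P).
    field. repeat split; lra.
  - intros j _. rewrite !pow_add, pow_1.
    assert (W := pow_lt _ p P). assert (W' := pow_lt _ j P).
    field. repeat split; lra.
Qed.

(** Truncating the double series to a square keeps the exchange of indices and the product formula
    exact at every [N]; limits are taken only afterwards. *)
Definition square_sum (a b : nat -> R) (s t N : nat) : R :=
  fsum (fun n => fsum (fun k =>
    a n * b k / (INR n ^ s * INR k ^ t * (INR n + INR k))) N) N.

Lemma square_sum_sym (a b : nat -> R) (s t N : nat) :
  square_sum a b s t N = square_sum b a t s N.
Proof.
  unfold square_sum. rewrite fsum_swap.
  apply fsum_ext; intros n _; apply fsum_ext; intros k _.
  rewrite (Rplus_comm (INR n)), (Rmult_comm (INR k ^ s)), (Rmult_comm (a k)).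
  reflexivity.
Qed.

(** Over a common denominator the numerators add up to [n + k], which cancels; the double sum then
    factors. *)
Lemma square_sum_step (a b : nat -> R) (s t N : nat) :
  square_sum a b (S s) t N + square_sum a b s (S t) N =
  fsum (fun n => a n / INR n ^ S s) N * fsum (fun k => b k / INR k ^ S t) N.
Proof.
  unfold square_sum. rewrite <- fsum_plus, Rmult_comm, <- fsum_scal.
  apply fsum_ext; intros n Hn.
  rewrite <- fsum_plus, Rmult_comm, <- fsum_scal.
  apply fsum_ext; intros k Hk.
  assert (P := INR_pos n ltac:(lia)). assert (Q := INR_pos k ltac:(lia)).
  assert (W := pow_lt _ s P). assert (W' := pow_lt _ t Q).
  simpl pow. field. repeat split; lra.
Qed.

(** Each [square_sum_step] moves one unit of exponent from [n] to [k] and flips the sign. At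
    [r = p - 1] the exponents [(p, 1)] have become [(1, p)], which [square_sum_sym] turns back with
    [a] and [b] exchanged. *)
Lemma square_sum_descent (a b : nat -> R) (p N r : nat) :
  (r < p)%nat ->
  square_sum a b p 1 N =
  fsum (fun i => sgn1 i * fsum (fun k => b k / INR k ^ (i + 1)) N *
                 fsum (fun n => a n / INR n ^ (p + 1 - i)) N) r
  + (-1) ^ r * square_sum a b (p - r) (r + 1) N.
Proof.
  induction r as [|r IH]; intros Hr.
  - rewrite fsum_0, Nat.sub_0_r. simpl. ring.
  - rewrite fsum_S, sgn1_S, IH by lia.
    assert (E := square_sum_step a b (p - S r) (r + 1) N).
    replace (S (p - S r)) with (p - r)%nat in E by lia.
    replace (p + 1 - S r)%nat with (p - r)%nat by lia.
    replace (S r + 1)%nat with (S (r + 1)) by lia.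
    rewrite Rplus_assoc. f_equal.
    rewrite Rmult_assoc, (Rmult_comm (fsum _ N) (fsum _ N)), <- E.
    simpl ((-1) ^ S r). ring.
Qed.

(** By partial fractions the full row sums to [c / (n + 1)]. Its terms beyond [N] are at most
    [1 / (k (k + 1))], which telescopes to a bound independent of [n]. *)
Lemma row_tail_le (b : nat -> R) (n N : nat) (c : R) :
  (forall k, Rabs (b k) <= 1) ->
  is_sum (fun k => b k * (/ INR k - / (INR k + INR n + 1))) c ->
  Rabs (fsum (fun k => b k / (INR k * (INR k + INR n + 1))) N
        - c / (INR n + 1)) <= / (INR N + 1).
Proof.
  intros Hb Hc. assert (Pn := pos_INR n).
  set (f := fun k => b k / (INR k * (INR k + INR n + 1))).
  assert (S1 : is_sum f (/ (INR n + 1) * c)).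
  { apply is_sum_ext with (2 := is_sum_scal (/ (INR n + 1)) _ _ Hc).
    intros k Hk. assert (P := INR_pos k Hk). unfold f. field. lra. }
  assert (T : forall d, Rabs (fsum f N - fsum f (d + N))
              <= / (INR N + 1) - / (INR (d + N) + 1)).
  { induction d as [|d IH].
    - simpl. unfold Rminus. rewrite !Rplus_opp_r, Rabs_R0. lra.
    - simpl (S d + N)%nat. rewrite fsum_S.
      replace (fsum f N - (fsum f (d + N) + f (S (d + N))))
        with ((fsum f N - fsum f (d + N)) + - f (S (d + N))) by ring.
      eapply Rle_trans; [apply Rabs_triang|]. rewrite Rabs_Ropp.
      enough (Rabs (f (S (d + N)))
        <= / (INR (d + N) + 1) - / (INR (S (d + N)) + 1)) by lra.
      unfold f. rewrite S_INR. set (x := INR (d + N)).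
      assert (Px : 0 <= x) by apply pos_INR.
      replace (/ (x + 1) - / (x + 1 + 1)) with (/ ((x + 1) * (x + 1 + 1)))
        by (field; lra).
      unfold Rdiv. rewrite Rabs_mult.
      assert (0 < (x + 1) * (x + 1 + INR n + 1))
        by (apply Rmult_lt_0_compat; lra).
      rewrite (Rabs_pos_eq (/ _)) by (left; now apply Rinv_0_lt_compat).
      rewrite <- (Rmult_1_l (/ ((x + 1) * (x + 1 + 1)))).
      apply Rmult_le_compat; [apply Rabs_pos| |apply Hb|].
      + left; now apply Rinv_0_lt_compat.
      + apply Rinv_le_contravar; [apply Rmult_lt_0_compat; lra|].
        apply Rmult_le_compat_l; lra. }
  replace (c / (INR n + 1)) with (/ (INR n + 1) * c) by (field; lra).
  (* Letting [d] grow turns the bound on finite blocks into one on the whole tail. *)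
  apply (is_lim_seq_le (fun d => Rabs (fsum f N - fsum f (d + N)))
           (fun _ => / (INR N + 1))
           (Finite (Rabs (fsum f N - / (INR n + 1) * c)))
           (Finite (/ (INR N + 1)))).
  - intros d. eapply Rle_trans; [apply T|].
    assert (0 < / (INR (d + N) + 1)); [|lra].
    apply Rinv_0_lt_compat. generalize (pos_INR (d + N)); lra.
  - apply (is_lim_seq_abs _ (Finite (fsum f N - / (INR n + 1) * c))).
    apply is_lim_seq_minus'; [apply is_lim_seq_const|].
    apply (is_lim_seq_incr_n (fsum f)). exact S1.
  - apply is_lim_seq_const.
Qed.

(* Summing the tail bound of the rows gives an error of at most
   [H 1 N / (N + 1)], so no theorem on rearranging double series is needed. *)
Lemma square_sum_lim (a b c : nat -> R) (p : nat) (J : R) :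
  (1 <= p)%nat ->
  (forall n, Rabs (a n) <= 1) -> (forall k, Rabs (b k) <= 1) ->
  (forall n, is_sum (fun k => b k * (/ INR k - / (INR k + INR n + 1))) (c n)) ->
  is_sum (fun n => a n / INR n ^ (p + 1) * c (n - 1)%nat) J ->
  is_lim_seq (square_sum a b p 1) J.
Proof.
  intros Hp Ha Hb Hc HJ.
  set (g := fun n => a n / INR n ^ (p + 1) * c (n - 1)%nat) in *.
  assert (D : is_lim_seq (fun N => square_sum a b p 1 N - fsum g N) 0).
  { apply is_lim_seq_abs_0.
    apply (is_lim_seq_le_le (fun _ => 0)) with (fun N => H 1 N / (INR N + 1));
      [|apply is_lim_seq_const|apply H1_div_tends_0].
    intros N. split; [apply Rabs_pos|].
    unfold square_sum. rewrite <- fsum_minus.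
    (* Row [n] carries a weight of size at most [1 / n], because [p >= 1], and a tail of size at
       most [1 / (N + 1)]. *)
    replace (H 1 N / (INR N + 1))
      with (fsum (fun n => / (INR N + 1) * / INR n ^ 1) N)
      by (rewrite fsum_scal; unfold H, Rdiv; ring).
    apply fsum_Rabs_le. intros n Hn.
    assert (P := INR_pos n ltac:(lia)).
    assert (W := pow_lt _ p P).
    assert (E : INR (n - 1) + 1 = INR n)
      by (rewrite <- S_INR; f_equal; lia).
    assert (R := row_tail_le b (n - 1) N (c (n - 1)%nat) Hb (Hc _)).
    rewrite E in R.
    replace (fsum (fun k => a n * b k /
       (INR n ^ p * INR k ^ 1 * (INR n + INR k))) N - g n)
      with (a n * / INR n ^ p *
        (fsum (fun k => b k / (INR k * (INR k + INR (n - 1) + 1))) N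
         - c (n - 1)%nat / INR n)).
    - rewrite Rabs_mult, Rmult_comm, pow_1.
      apply Rmult_le_compat; try apply Rabs_pos; [exact R|].
      rewrite Rabs_mult.
      assert (Q := inv_pow_bounds n p ltac:(lia)).
      assert (Q' := inv_pow_le_inv n p ltac:(lia) Hp).
      rewrite (Rabs_pos_eq (/ _)) by lra.
      rewrite <- (Rmult_1_l (/ INR n)).
      apply Rmult_le_compat; [apply Rabs_pos|lra|apply Ha|lra].
    - rewrite Rmult_minus_distr_l, <- fsum_scal. f_equal.
      + apply fsum_ext. intros k Hk.
        assert (INR k <> 0) by (apply not_0_INR; lia).
        assert (Pk := pos_INR k).
        rewrite Rplus_assoc, E, pow_1. field. repeat split; lra.
      + unfold g. rewrite pow_add, pow_1. field. lra. }
  apply is_lim_seq_ext with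
    (fun N => (square_sum a b p 1 N - fsum g N) + fsum g N);
    [intros N; ring|].
  replace (Finite J) with (Finite (0 + J)) by (f_equal; ring).
  now apply is_lim_seq_plus'.
Qed.

Lemma is_lim_seq_fsum (u : nat -> nat -> R) (v : nat -> R) (r : nat) :
  (forall i, (1 <= i <= r)%nat -> is_lim_seq (fun N => u N i) (v i)) ->
  is_lim_seq (fun N => fsum (u N) r) (fsum v r).
Proof.
  induction r as [|r IH]; intros E.
  - rewrite fsum_0. apply is_lim_seq_ext with (fun _ => 0).
    + intros N. now rewrite fsum_0.
    + apply is_lim_seq_const.
  - rewrite fsum_S. apply is_lim_seq_ext with (fun N => fsum (u N) r + u N (S r)).
    + intros N. now rewrite fsum_S.
    + apply is_lim_seq_plus'; [apply IH; intros i Hi|]; apply E; lia.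
Qed.

(** [J] is the limit of a square sum; [p - 1] steps of descent rewrite that sum through products of
    partial sums and the exchanged square sum, whose limit is [K]. Uniqueness of limits
    concludes. *)
Lemma Hbar_diff_reciprocity (l m p : nat) (J K : R) :
  (1 <= p)%nat ->
  is_sum (fun n => Hbar l n / INR n ^ (p + 1) * Hbar_diff m (n - 1)) J ->
  is_sum (fun n => Hbar m n / INR n ^ (p + 1) * Hbar_diff l (n - 1)) K ->
  J = fsum (fun i => sgn1 i * S_B_q m (i + 1) * S_B_q l (p + 1 - i)) (p - 1)
      + (-1) ^ (p - 1) * K.
Proof.
  intros Hp HJ HK.
  assert (LJ := square_sum_lim _ _ _ p J Hp (Rabs_Hbar_le_1 l)
    (Rabs_Hbar_le_1 m) (Hbar_diff_is_sum m) HJ).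
  assert (LK := square_sum_lim _ _ _ p K Hp (Rabs_Hbar_le_1 m)
    (Rabs_Hbar_le_1 l) (Hbar_diff_is_sum l) HK).
  assert (B : forall a q, (2 <= q)%nat ->
    is_lim_seq (fsum (fun n => Hbar a n / INR n ^ q)) (S_B_q a q)).
  { intros a q Hq. apply is_sum_H1_dominated; [assumption|].
    apply Rabs_Hbar_le_H1. }
  assert (L : is_lim_seq (square_sum (Hbar l) (Hbar m) p 1)
    (fsum (fun i => sgn1 i * S_B_q m (i + 1) * S_B_q l (p + 1 - i)) (p - 1)
      + (-1) ^ (p - 1) * K)).
  { eapply is_lim_seq_ext.
    { intros N. symmetry. apply (square_sum_descent _ _ p N (p - 1)). lia. }
    apply is_lim_seq_plus'.
    - apply is_lim_seq_fsum. intros i Hi.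
      apply is_lim_seq_mult'; [|apply B; lia].
      apply is_lim_seq_mult'; [apply is_lim_seq_const|apply B; lia].
    - apply (is_lim_seq_scal_l _ _ (Finite K)).
      replace (p - (p - 1))%nat with 1%nat by lia.
      replace (p - 1 + 1)%nat with p by lia.
      eapply is_lim_seq_ext; [|exact LK].
      intros N. apply square_sum_sym. }
  apply is_lim_seq_unique in LJ. apply is_lim_seq_unique in L.
  rewrite LJ in L. now injection L.
Qed.

Theorem theorem5p2 (l m p : nat)
  (hl : (1 <= l)%nat) (hm : (1 <= m)%nat) (hp : (1 <= p)%nat) :
  (-1) ^ m *
    Series1 (fun n => Hbar l n / INR n ^ (p + 1) *
                      fsum (fun i => Hbar 1 i / INR i ^ m * sgn1 i) n)
  + (-1) ^ (p + l) *
    Series1 (fun n => Hbar m n / INR n ^ (p + 1) *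
                      fsum (fun i => Hbar 1 i / INR i ^ l * sgn1 i) n)
  =
  fsum (fun i => sgn1 i * S_B_q m (i + 1) * S_B_q l (p + 1 - i)) (p - 1)
  + (-1) ^ (p - 1) * zetabar (l + 1) * S_B_q m (p + 1)
  - zetabar (m + 1) * S_B_q l (p + 1)
  + (-1) ^ (p - 1) *
    fsum (fun j => sgn1 j * zetabar (l + 1 - j) *
                   (S_BN_q m j (p + 1) - S_B_q m (p + j + 1))) (l - 1)
  - fsum (fun j => sgn1 j * zetabar (m + 1 - j) *
                   (S_BN_q l j (p + 1) - S_B_q l (p + j + 1))) (m - 1)
  + (-1) ^ (p + l) * ln 2 *
    (S_BN_q m l (p + 1) + S_BB_q m l (p + 1)
     - S_B_q m (p + l + 1) - S_B_Bq m (p + l + 1))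
  + (-1) ^ m * ln 2 *
    (S_BN_q l m (p + 1) + S_BB_q l m (p + 1)
     - S_B_q l (m + p + 1) - S_B_Bq l (m + p + 1))
  + (-1) ^ (p + l) * S_1B_Bq m (p + l + 1)
  + (-1) ^ m * S_1B_Bq l (p + m + 1).
Proof.
  assert (E := Hbar_diff_reciprocity l m p _ _ hp
    (Hbar_diff_weighted_is_sum l m p hm hp)
    (Hbar_diff_weighted_is_sum m l p hl hp)).
  replace (m + p + 1)%nat with (p + m + 1)%nat by lia.
  destruct l as [|l]; [lia|]. destruct m as [|m]; [lia|].
  destruct p as [|p]; [lia|].
  (* The last terms [j = l] and [j = m] carry [zetabar 1 = ln 2]; the theorem lists them with its
     other [ln 2] terms. *)
  rewrite (fsum_S _ l), (fsum_S _ m) in E.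
  replace (S l + 1 - S l)%nat with 1%nat in E by lia.
  replace (S m + 1 - S m)%nat with 1%nat in E by lia.
  rewrite zetabar_1, !sgn1_S in E.
  replace (S l - 1)%nat with l by lia.
  replace (S m - 1)%nat with m by lia.
  replace (S p - 1)%nat with p in * by lia.
  (* Moving the second double sum to the left changes its sign [(-1)^(p-1) (-1)^l] into
     [(-1)^p (-1)^l]; with the powers split, the claim is linear in the products that occur. *)
  rewrite (pow_add _ (S p) (S l)).
  simpl pow in *. lra.
Qed.
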